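(* Let $\Lambda\subset\mathbb R^2$ be a unimodular lattice, $\tau>0$ with $\mathcal F(\Lambda,\tau)\ne\emptyset$, and let $\begin{pmatrix}q_1 \\ a_1\end{pmatrix},\begin{pmatrix}q_2 \\ a_2\end{pmatrix}\in\mathcal F(\Lambda,\tau)$ be two primitive vectors with consecutive slopes. Then: (a) For $\alpha\in\left[\frac{a_1}{q_1},\frac{a_2}{q_2}\right]$, the lattice $h_\alpha\cdot\Lambda$ has nonzero horizontal lattice points of length not exceeding $\tau$ only for $\alpha=\frac{a_1}{q_1}$ and $\alpha=\frac{a_2}{q_2}$. (b) The columns of the matrix $\begin{pmatrix}\frac{q_1}{\tau}&\frac{q_2}{\tau} \\ 0&\left(\frac{q_1}{\tau}\right)^{-1}\end{pmatrix}$ form a positively oriented basis of $s_{1/\tau}h_{a_1/q_1}\cdot\Lambda=h_{\frac{a_1}{q_1}\tau^2}(s_{1/\tau}\cdot\Lambda)$, and are two primitive points with consecutive slopes in $\mathcal F(s_{1/\tau}h_{a_1/q_1}\cdot\Lambda,1)$, with $\begin{pmatrix}q_1/\tau \\ 0\end{pmatrix}$ being the shortest horizontal vector of $s_{1/\tau}h_{a_1/q_1}\cdot\Lambda$ with positive $x$-component. (c) The lattice $s_{1/\tau}h_{a_1/q_1}\cdot\Lambda$ can be identified with the point $\left(\frac{q_1}{\tau},\frac{q_2}{\tau}\right)$ of the Farey triangle $\mathscr T$; that is, $\left(\frac{q_1}{\tau},\frac{q_2}{\tau}\right)\in\mathscr T$, and it is the unique $(x,y)\in\mathscr T$ with $\Lambda_{x,y}=s_{1/\tau}h_{a_1/q_1}\cdot\Lambda$.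 (d) If $\begin{pmatrix}q_1 \\ a_1\end{pmatrix},\begin{pmatrix}q_2 \\ a_2\end{pmatrix},\begin{pmatrix}q_3 \\ a_3\end{pmatrix}\in\mathcal F(\Lambda,\tau)$ have consecutive slopes, then $T\left(\frac{q_1}{\tau},\frac{q_2}{\tau}\right)=\left(\frac{q_2}{\tau},\frac{q_3}{\tau}\right)$, where $T$ is the BCZ map.
   Context: A unimodular lattice has covolume $1$. A nonzero $v\in\Lambda$ is primitive if the only lattice point in $\{rv\mid r\in[0,1)\}$ is the origin; $\Lambda_{\mathrm{prim}}$ is the set of primitive points. $S_\tau=(0,\tau]\times\mathbb R$ and $\mathcal F(\Lambda,\tau)=\Lambda_{\mathrm{prim}}\cap S_\tau$. Two points of $\mathcal F(\Lambda,\tau)$, in the given order, have consecutive slopes if the slope $a_1/q_1$ of the first is strictly less than the slope $a_2/q_2$ of the second and no point of $\mathcal F(\Lambda,\tau)$ has slope strictly in between; three points have consecutive slopes if the first two do and the last two do. Matrices: $h_s=\begin{pmatrix}1&0 \\ -s&1\end{pmatrix}$ for $s\in\mathbb R$, $s_r=\begin{pmatrix}r&0 \\ 0&r^{-1}\end{pmatrix}$ for $r>0$. Farey triangle: $\mathscr T=\{(x,y)\in\mathbb R^2\mid 0<x,y\le1,\ x+y>1\}$. For $(x,y)\in\mathscr T$, $\Lambda_{x,y}=\begin{pmatrix}x&y \\ 0&x^{-1}\end{pmatrix}\mathbb Z^2$. BCZ map: $T:\mathscr T\to\mathscr T$, $T(x,y)=\left(y,\left\lfloor\frac{1+x}{y}\right\rfloor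 y-x\right)$. *)

(* Defs.v *)
From HB Require Import structures.
From mathcomp Require Import all_boot all_order all_algebra.
From mathcomp Require Import all_classical all_reals.
From mathcomp Require Import lra.

Set Implicit Arguments.
Unset Strict Implicit.
Unset Printing Implicit Defensive.

Import Order.TTheory GRing.Theory Num.Theory.
Local Open Scope classical_set_scope.
Local Open Scope ring_scope.

Section Definitions.
Context {R : realType}.
Implicit Types (x y a b c d q r s t : R) (u v w : 'cV[R]_2).
Implicit Types (A B : 'M[R]_2) (L F : set 'cV[R]_2) (p : R * R).

Definition vec2 x y : 'cV[R]_2 := \col_i (if i == 0 then x else y).

(* The matrix with rows (a, b) and (c, d). *)
Definition mx2 a b c d : 'M[R]_2 :=
  \matrix_(i, j) (if i == 0 then (if j == 0 then a else b)
                  else (if j == 0 then c else d)).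

Definition xcoord v : R := v 0 0.
Definition ycoord v : R := v 1 0.

(* The Euclidean length; the library norm on matrices is the sup norm. *)
Definition length2 v : R := Num.sqrt (xcoord v ^+ 2 + ycoord v ^+ 2).

Definition horizontal v : Prop := ycoord v = 0.

Definition slope v : R := ycoord v / xcoord v.

Definition Z2 : set 'cV[R]_2 :=
  [set map_mx intr z | z in [set: 'cV[int]_2]].

Definition act A L : set 'cV[R]_2 := [set A *m v | v in L].

(* The columns of B are an R-basis of R^2 whose Z-span is L. *)
Definition lattice_basis B L : Prop := B \in unitmx /\ L = act B Z2.

(* The covolume of a lattice is |det B| for any of its bases B. *)
Definition unimodular_lattice L : Prop :=
  exists2 B, lattice_basis B L & `|\det B| = 1.

Definition positively_oriented_basis B L : Prop :=
  lattice_basis B L /\ 0 < \det B.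

Definition primitive L : set 'cV[R]_2 :=
  [set v | [/\ L v, v <> 0 & L `&` [set r *: v | r in `[0, 1[] = [set 0]]].

Definition strip t : set 'cV[R]_2 := [set v | 0 < xcoord v <= t].

Definition farey_points L t : set 'cV[R]_2 := primitive L `&` strip t.

Definition consecutive2 F u v : Prop :=
  [/\ F u, F v, slope u < slope v
    & ~ exists2 w, F w & slope u < slope w < slope v].

Definition consecutive3 F u v w : Prop :=
  consecutive2 F u v /\ consecutive2 F v w.

Definition h_mx s : 'M[R]_2 := mx2 1 0 (- s) 1.
Definition s_mx r : 'M[R]_2 := mx2 r 0 0 r^-1.

(* v is the (unique) element of F of minimal length. *)
Definition the_shortest F v : Prop :=
  F v /\ forall w, F w -> w <> v -> length2 v < length2 w.

Definition farey_triangle : set (R * R) :=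
  [set p | [/\ 0 < p.1 <= 1, 0 < p.2 <= 1 & 1 < p.1 + p.2]].

Definition farey_lattice p : set 'cV[R]_2 := act (mx2 p.1 p.2 0 p.1^-1) Z2.

(* The formula is total on R * R; it is only meaningful on the Farey triangle,
   which it maps to itself (bcz_farey_triangle). *)
Definition bcz p : R * R :=
  (p.2, (Num.floor ((1 + p.1) / p.2))%:~R * p.2 - p.1).

Lemma bcz_farey_triangle p : farey_triangle p -> farey_triangle (bcz p).
Proof.
case: p => x y [/= /andP[x0 x1] /andP[y0 y1] xy].
rewrite /farey_triangle /bcz /=; set k := Num.floor _.
have kle : k%:~R * y <= 1 + x by rewrite -ler_pdivlMr // floor_le.
have klt : 1 + x < (k%:~R + 1) * y.
  by rewrite -ltr_pdivrMr // -[X in _ < _ + X]/(1%:~R) -intrD floorD1_gt.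
rewrite mulrDl mul1r in klt; set z := _ * y in kle klt *.
by split; [rewrite y0 y1 | apply/andP; split; lra | lra].
Qed.

End Definitions.

(* Main.v *)
(* Two consecutive points u, v of F(L, t) form a basis of L of determinant 1:
   complete u to such a basis (u, w) and write v = m u + n w, n >= 1. If n >= 2,
   then n does not divide m, and w + k u with k = ceil (m / n) is a primitive
   point of the strip lying strictly between u and v. Moreover u + v is primitive
   and its slope lies in between, so x(u) + x(v) > t. Conversely, a lattice point
   strictly between u and v is a combination of them with coefficients >= 1, so
   its abscissa is at least x(u) + x(v) > t. For three consecutive
   points, v3 = k v2 - v1 for an integer k, and x(v3) <= t < x(v2) + x(v3)
   identifies k as the floor in the BCZ map. *)

Require Import Defs.
From mathcomp Require Import all_boot all_order all_algebra.
From mathcomp Require Import all_classical all_reals.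
From mathcomp Require Import ring lra zify.

Import Order.TTheory GRing.Theory Num.Theory.
Local Open Scope classical_set_scope.
Local Open Scope ring_scope.

Set Implicit Arguments.
Unset Strict Implicit.

Section Plane.
Context {R : realType}.
Implicit Types (x y a b c d e f g h t : R) (u v w : 'cV[R]_2)
  (A B : 'M[R]_2) (L : set 'cV[R]_2).

(** * Coordinates, matrices and determinants in the plane *)

Lemma cV2P u v : xcoord u = xcoord v -> ycoord u = ycoord v -> u = v.
Proof.
move=> ex ey; apply/colP => -[[|[|//]] lti].
  by rewrite (_ : Ordinal lti = 0) //; apply: val_inj.
by rewrite (_ : Ordinal lti = 1) //; apply: val_inj.
Qed.

Lemma xcoordD u v : xcoord (u + v) = xcoord u + xcoord v.
Proof. by rewrite /xcoord mxE. Qed.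

Lemma ycoordD u v : ycoord (u + v) = ycoord u + ycoord v.
Proof. by rewrite /ycoord mxE. Qed.

Lemma xcoordN u : xcoord (- u) = - xcoord u.
Proof. by rewrite /xcoord mxE. Qed.

Lemma ycoordN u : ycoord (- u) = - ycoord u.
Proof. by rewrite /ycoord mxE. Qed.

Lemma xcoordZ a u : xcoord (a *: u) = a * xcoord u.
Proof. by rewrite /xcoord mxE. Qed.

Lemma ycoordZ a u : ycoord (a *: u) = a * ycoord u.
Proof. by rewrite /ycoord mxE. Qed.

Lemma xcoord0 : xcoord (0 : 'cV[R]_2) = 0.
Proof. by rewrite /xcoord mxE. Qed.

Lemma ycoord0 : ycoord (0 : 'cV[R]_2) = 0.
Proof. by rewrite /ycoord mxE. Qed.

Lemma xcoord_vec2 x y : xcoord (vec2 x y) = x.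
Proof. by rewrite /xcoord mxE. Qed.

Lemma ycoord_vec2 x y : ycoord (vec2 x y) = y.
Proof. by rewrite /ycoord mxE. Qed.

Lemma mulmx_cV2 A v :
  A *m v = xcoord v *: col 0 A + ycoord v *: col 1 A.
Proof.
apply/colP => i; rewrite !mxE big_ord_recl big_ord1 ![A _ _ * _]mulrC.
by rewrite (_ : lift ord0 ord0 = 1) //; apply: val_inj.
Qed.

Lemma mulmx2 a b c d e f g h : mx2 a b c d *m mx2 e f g h =
  mx2 (a * e + b * g) (a * f + b * h) (c * e + d * g) (c * f + d * h).
Proof.
apply/matrixP => i j; rewrite !mxE big_ord_recl big_ord1 !mxE /=.
by case: ifP; case: ifP.
Qed.

Lemma xcoord_mx2 a b c d v :
  xcoord (mx2 a b c d *m v) = a * xcoord v + b * ycoord v.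
Proof. by rewrite mulmx_cV2 xcoordD !xcoordZ /xcoord !mxE /= !(mulrC (v _ _)). Qed.

Lemma ycoord_mx2 a b c d v :
  ycoord (mx2 a b c d *m v) = c * xcoord v + d * ycoord v.
Proof. by rewrite mulmx_cV2 ycoordD !ycoordZ /ycoord !mxE /= !(mulrC (v _ _)). Qed.

Definition coordE := (xcoordD, ycoordD, xcoordN, ycoordN, xcoordZ, ycoordZ,
  xcoord0, ycoord0, xcoord_vec2, ycoord_vec2, xcoord_mx2, ycoord_mx2).

Lemma col0_mx2 a b c d : col 0 (mx2 a b c d) = vec2 a c.
Proof. by apply: cV2P; rewrite /xcoord /ycoord !mxE. Qed.

Lemma col1_mx2 a b c d : col 1 (mx2 a b c d) = vec2 b d.
Proof. by apply: cV2P; rewrite /xcoord /ycoord !mxE. Qed.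

Lemma cV2_neq0P v : v <> 0 <-> xcoord v <> 0 \/ ycoord v <> 0.
Proof.
split=> [v0|[] + v0].
- by apply: contrapT => /not_orP[/contrapT vx /contrapT vy]; apply: v0;
    apply: cV2P; rewrite !coordE.
- by rewrite v0 !coordE.
- by rewrite v0 !coordE.
Qed.

(** Slopes are compared through the sign of this form: it is bilinear, and on a lattice with a basis
    of determinant 1 its values are integers. *)
Definition det2 u v := xcoord u * ycoord v - ycoord u * xcoord v.

Lemma det2_col A : \det A = det2 (col 0 A) (col 1 A).
Proof.
rewrite (expand_det_row _ 0) big_ord_recl big_ord1 /cofactor !det_mx11 !mxE.
have -> : lift ord0 ord0 = 1 :> 'I_2 by apply: val_inj.
have -> : lift 1 0 = 0 :> 'I_2 by apply: val_inj.
rewrite /= expr0 expr1 mul1r mulN1r mulrN [A 0 1 * _]mulrC.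
by rewrite /det2 /xcoord /ycoord !mxE.
Qed.

Lemma ltr_slope u v : 0 < xcoord u -> 0 < xcoord v ->
  (slope u < slope v) = (0 < det2 u v).
Proof.
move=> u0 v0; rewrite /slope /det2 ltr_pdivrMr // mulrAC ltr_pdivlMr // subr_gt0.
by rewrite [xcoord u * _]mulrC.
Qed.

(** * Lattices and their bases of determinant 1 *)

Lemma actM A B L : act A (act B L) = act (A *m B) L.
Proof.
apply/seteqP; split => w [].
  by move=> _ [z Lz <-] <-; exists z; rewrite // mulmxA.
by move=> z Lz <-; exists (B *m z); [exists z | rewrite mulmxA].
Qed.

Lemma act_Z2P A w : act A (@Z2 R) w <->
  exists m n : int, w = m%:~R *: col 0 A + n%:~R *: col 1 A.
Proof.
split=> [[_ [z _ <-] <-]|[m [n ->]]].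
  by exists (z 0 0), (z 1 0); rewrite mulmx_cV2 /xcoord /ycoord !mxE.
exists (map_mx intr (\col_i (if i == 0 then m else n))); first by eexists.
by rewrite mulmx_cV2 /xcoord /ycoord !mxE.
Qed.

(** Stated with vectors instead of a matrix, so that the integer coordinates of a lattice point are
    at hand and can be read off by [det2] against [u] and [v]. *)
Definition unit_basis L u v := det2 u v = 1 /\
  forall w, L w <-> exists m n : int, w = m%:~R *: u + n%:~R *: v.

Lemma unit_basis_mem L u v : unit_basis L u v -> L u /\ L v.
Proof.
move=> [_ LE]; split; apply/LE.
  by exists 1, 0; rewrite scale1r scale0r addr0.
by exists 0, 1; rewrite scale1r scale0r add0r.
Qed.

Lemma unit_basis_act A : \det A = 1 -> unit_basis (act A (@Z2 R)) (col 0 A) (col 1 A).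
Proof. by move=> dA; split; [rewrite -det2_col | exact: act_Z2P]. Qed.

Lemma unit_basis_shear L u w (k : int) :
  unit_basis L u w -> unit_basis L u (w + k%:~R *: u).
Proof.
move=> [uw LE]; split; first by rewrite -uw /det2 !coordE; ring.
move=> z; split=> [/LE[m [n ->]]|[m [n ->]]].
  exists (m - n * k), n.
  by apply: cV2P; rewrite !coordE; ring.
apply/LE; exists (m + n * k), n.
by apply: cV2P; rewrite !coordE; ring.
Qed.

(** Three such quarter turns lead from [(u, v)] to [(- v, u)], which carries facts about the second
    basis vector over to the first. *)
Lemma unit_basis_rot L u v : unit_basis L u v -> unit_basis L v (- u).
Proof.
move=> [uv LE]; split; first by rewrite -uv /det2 !coordE; ring.
move=> z; split=> [/LE[m [n ->]]|[m [n ->]]].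
  by exists n, (- m); apply: cV2P; rewrite !coordE; ring.
by apply/LE; exists (- n), m; apply: cV2P; rewrite !coordE; ring.
Qed.

(** If [r *: v] is the lattice point with coordinates [m], [n], then pairing with [u] gives [r = n],
    and the only integer in [[0, 1[] is 0. *)
Lemma unit_basis_primitive L u v : unit_basis L u v -> primitive L v.
Proof.
move=> Luv; have [uv LE] := Luv.
have v0 : v <> 0.
  by move=> v0; move: uv; rewrite /det2 v0 !coordE !mulr0 subrr => /esym/eqP;
    rewrite oner_eq0.
split=> //; first exact: (unit_basis_mem Luv).2.
apply/seteqP; split=> w /=; last first.
  move=> ->; split; first by apply/LE; exists 0, 0; rewrite !scale0r addr0.
  by exists 0; rewrite ?scale0r //= in_itv /= lexx ltr01.
move=> [/LE[m [n wE]] [r + rw]]; rewrite /= in_itv /= => /andP[r0 r1].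
have rn : r = n%:~R.
  have : det2 u w = det2 u w by [].
  rewrite {1}wE -{1}rw.
  have -> : det2 u (r *: v) = r * det2 u v by rewrite /det2 !coordE; ring.
  have -> : det2 u (m%:~R *: u + n%:~R *: v) = n%:~R * det2 u v.
    by rewrite /det2 !coordE; ring.
  by rewrite uv !mulr1.
have n0 : n = 0.
  by move: r0 r1; rewrite rn ler0z ltrz1; lia.
by rewrite -rw rn n0 scale0r.
Qed.

(** Primitivity makes the coordinates of [u] in a basis coprime; a Bezout relation between them
    supplies the second vector. *)
Lemma unit_basis_completion L u :
  unimodular_lattice L -> primitive L u -> exists w, unit_basis L u w.
Proof.
move=> [B [_ ->] dB] [/act_Z2P[i [j uE]] u0 uL].
set b1 := col 0 B in uE; set b2 := col 1 B in uE.
(* The sign of [\det B], its own inverse, will correct the orientation. *)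
have [e dE ee] : exists2 e : int, det2 b1 b2 = e%:~R & e * e = 1.
  rewrite -det2_col; case: (lerP 0 (\det B)) => [B0|B0].
    by exists 1; rewrite // -dB ger0_norm.
  by exists (- 1); rewrite // rmorphN /= -[1%:~R]/1 -dB ltr0_norm // opprK.
have gcd1 : gcdz i j = 1.
  apply: contrapT => g1.
  have /dvdzP[i' iE] : (gcdz i j %| i)%Z by apply: dvdz_gcdl.
  have /dvdzP[j' jE] : (gcdz i j %| j)%Z by apply: dvdz_gcdr.
  have : 0 <= gcdz i j by [].
  move: g1 iE jE; set g := gcdz i j => g1 iE jE g0.
  have gn0 : g != 0.
    by apply/eqP => g0'; apply: u0; rewrite uE iE jE g0' !mulr0 !scale0r addr0.
  have gR : 1 < g%:~R :> R by rewrite ltr1z; lia.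
  have gR0 : g%:~R != 0 :> R by rewrite intr_eq0.
  (* If the gcd [g] exceeded 1, [u / g] would be a nonzero lattice point on the half-open segment
     from 0 to [u]. *)
  have : [set 0] (g%:~R^-1 *: u).
    rewrite -uL; split.
      apply/act_Z2P; exists i', j'; rewrite uE iE jE.
      by apply: cV2P; rewrite !coordE !rmorphM /=; field.
    exists g%:~R^-1 => //=; rewrite in_itv /= invf_lt1; last by lra.
    by rewrite gR invr_ge0 andbT; lra.
  move=> /= gu0; apply: u0.
  by rewrite -[u]scale1r -(mulfV gR0) -scalerA gu0 scaler0.
have [s [t stE]] := Bezoutz i j; rewrite gcd1 in stE.
have stR : s%:~R * i%:~R + t%:~R * j%:~R = 1 :> R by rewrite -!rmorphM -rmorphD stE.
have eeR : e%:~R * e%:~R = 1 :> R by rewrite -rmorphM ee.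
(* In the basis [(b1, b2)] the vectors are [(i, j)] and [e (- t, s)], so their determinant is
   [e (s i + t j) e = 1]. *)
exists (e%:~R *: (s%:~R *: b2 - t%:~R *: b1)); split.
  rewrite (_ : det2 _ _ = e%:~R * (s%:~R * i%:~R + t%:~R * j%:~R) * det2 b1 b2).
    by rewrite stR mulr1 dE.
  by rewrite uE /det2 !coordE; ring.
move=> z; split=> [/act_Z2P[m [n]]|[m [n ->]]]; rewrite -/b1 -/b2.
  (* Cramer's rule: these are [det2 z w] and [det2 u z] for the new vector [w]. *)
  move=> ->; exists (m * s + n * t), (e * (n * i - m * j)).
  have mE : m%:~R = m%:~R * (s%:~R * i%:~R + t%:~R * j%:~R) :> R by rewrite stR mulr1.
  have nE : n%:~R = n%:~R * (s%:~R * i%:~R + t%:~R * j%:~R) :> R by rewrite stR mulr1.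
  rewrite rmorphM /= scalerA mulrAC eeR mul1r uE.
  by apply: cV2P; rewrite !coordE {1}mE {1}nE; ring.
apply/act_Z2P; exists (m * i - n * e * t), (m * j + n * e * s).
by rewrite -/b1 -/b2 uE; apply: cV2P; rewrite !coordE; ring.
Qed.

(** The coefficients of [w] on [u] and [v] are [det2 w v] and [det2 u w]: positive integers, hence
    at least 1. Primitivity of [w] is not assumed. *)
Lemma unit_basis_between L u v w : unit_basis L u v -> L w ->
  0 < xcoord u -> 0 < xcoord v -> 0 < det2 u w -> 0 < det2 w v ->
  xcoord u + xcoord v <= xcoord w.
Proof.
move=> [uv LE] /LE[m [n ->]] u0 v0.
have -> : det2 u (m%:~R *: u + n%:~R *: v) = n%:~R * det2 u v.
  by rewrite /det2 !coordE; ring.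
have -> : det2 (m%:~R *: u + n%:~R *: v) v = m%:~R * det2 u v.
  by rewrite /det2 !coordE; ring.
rewrite uv !mulr1 !coordE !ltr0z !gtz0_ge1 -!(ler1z R) => n1 m1.
by apply: lerD; rewrite ler_peMl // ltW.
Qed.

(** * Consecutive points of the strip and bases of determinant 1 *)

Lemma unit_basis_consecutive2 L t u v : unit_basis L u v ->
  0 < xcoord u <= t -> 0 < xcoord v <= t -> t < xcoord u + xcoord v ->
  consecutive2 (farey_points L t) u v.
Proof.
move=> Luv ut vt uvt; have [uv LE] := Luv.
have [u0 _] := andP ut; have [v0 _] := andP vt.
split; [split=> // | split=> // | | ].
- by have := unit_basis_primitive (unit_basis_rot (unit_basis_rot (unit_basis_rot Luv)));
  rewrite opprK.
- exact: unit_basis_primitive Luv.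
- by rewrite ltr_slope // uv.
move=> [w [[Lw _ _] /andP[w0 wt]]]; rewrite !ltr_slope // => /andP[uw wv].
have := unit_basis_between Luv Lw u0 v0 uw wv; lra.
Qed.

Lemma consecutive2_unit_basis L t u v : unimodular_lattice L ->
  consecutive2 (farey_points L t) u v ->
  unit_basis L u v /\ t < xcoord u + xcoord v.
Proof.
move=> Lu [[up /andP[u0 ut]] [vp /andP[v0 vt]] + nobtw].
rewrite ltr_slope // => duv.
have [w Luw] := unit_basis_completion Lu up.
(* Any [z] completing [u] has slope above that of [u], so only the strip and the comparison with [v]
   remain to be checked. *)
have nobtw' z : unit_basis L u z -> 0 < xcoord z <= t -> 0 < det2 z v -> False.
  move=> Luz /andP[z0 zt] zv; apply: nobtw; exists z.
    by split; [exact: unit_basis_primitive Luz | apply/andP].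
  by rewrite !ltr_slope // zv Luz.1 ltr01.
have [uw LE] := Luw.
have /LE[m [n vE]] : L v by case: vp.
have dn : det2 u v = n%:~R.
  have -> : det2 u v = n%:~R * det2 u w by rewrite vE /det2 !coordE; ring.
  by rewrite uw mulr1.
have n0 : 0 < n by rewrite -(ltr0z R) -dn.
(* The ceiling of [m / n], written as a floor; hence [0 <= k n - m < n]. *)
pose k := ((m + n - 1) %/ n)%Z.
have knm : 0 <= k * n - m < n.
  have := divz_eq (m + n - 1) n; rewrite -/k.
  have := modz_ge0 (m + n - 1) (lt0r_neq0 n0).
  have := ltz_pmod (m + n - 1) n0.
  lia.
have Lz := unit_basis_shear k Luw; set z := w + _ in Lz.
have zn : n%:~R *: z = v + (k * n - m)%:~R *: u.
  by rewrite vE /z; apply: cV2P; rewrite !coordE; ring.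
have dzv : det2 z v = (k * n - m)%:~R.
  have -> : det2 z v = (k * n - m)%:~R * det2 u w.
    by rewrite vE /z /det2 !coordE; ring.
  by rewrite uw mulr1.
move: knm zn dzv; set r := k * n - m => /andP[r0 rn] zn dzv.
have nR : 0 < n%:~R :> R by rewrite ltr0z.
have xz : n%:~R * xcoord z = xcoord v + r%:~R * xcoord u.
  by rewrite -xcoordZ zn !coordE.
have rR : 0 <= r%:~R :> R by rewrite ler0z.
have rnR : r%:~R + 1 <= n%:~R :> R by rewrite -[1]/(1%:~R) -intrD ler_int; lia.
(* Otherwise [z = (v + r u) / n] separates [u] and [v]: since [r + 1 <= n], its abscissa is at most
   [t]. *)
have req0 : r = 0.
  apply: contrapT => /eqP rn0; apply: (nobtw' z Lz); last first.
    by rewrite dzv ltr0z lt0r rn0.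
  have ru0 : 0 <= r%:~R * xcoord u by rewrite mulr_ge0 // ltW.
  apply/andP; split; first by rewrite -(pmulr_rgt0 _ nR) xz; lra.
  rewrite -(ler_pM2l nR) xz.
  have : r%:~R * xcoord u <= r%:~R * t by rewrite ler_wpM2l.
  have : (r%:~R + 1) * t <= n%:~R * t by rewrite ler_wpM2r // ltW // (lt_le_trans u0).
  lra.
have vz : v = n%:~R *: z by rewrite zn req0 scale0r addr0.
(* [v = n z] with [n > 1] would put [z] on the half-open segment from 0 to [v], against
   primitivity. *)
have n1 : n = 1.
  apply: contrapT => nn1.
  have n2 : 1 < n%:~R :> R by rewrite ltr1z; lia.
  have : [set 0] z.
    have [_ _ <-] := vp; split; first exact: (unit_basis_mem Lz).2.
    exists n%:~R^-1 => /=.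
      by rewrite in_itv /= invf_lt1 // n2 invr_ge0 ltW.
    by rewrite vz scalerA mulVf ?scale1r // lt0r_neq0.
  by move=> z0; case: vp => _ + _; rewrite vz z0 scaler0.
have Luv : unit_basis L u v by rewrite vz n1 scale1r.
split=> //; rewrite ltNge; apply/negP => uvt.
(* The second vector is now [v + u], which would lie in the strip between [u] and [v]. *)
have Luvu := unit_basis_shear 1 Luv.
apply: (nobtw' _ Luvu); first by rewrite !coordE; lra.
by rewrite (_ : det2 _ _ = det2 u v) // /det2 !coordE; ring.
Qed.

(** The lattice determines [x] as the least positive abscissa of a horizontal point. Points at
    height [1 / x] then determine [y] modulo [x], and the triangle confines [y] to []1 - x, 1]], of
    length [x]. *)
Lemma farey_lattice_inj (p p' : R * R) : farey_triangle p -> farey_triangle p' ->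
  farey_lattice p = farey_lattice p' -> p = p'.
Proof.
case: p p' => [x y] [x' y'] [/= /andP[x0 x1] /andP[y0 y1] xy].
move=> [/= /andP[x'0 x'1] /andP[y'0 y'1] xy'] E.
have memP (a b : R) w : 0 < a -> farey_lattice (a, b) w <->
    exists m n : int, w = vec2 (m%:~R * a + n%:~R * b) (n%:~R / a).
  move=> a0; rewrite /farey_lattice act_Z2P /= col0_mx2 col1_mx2.
  by split=> -[m [n ->]]; exists m, n; apply: cV2P; rewrite !coordE ?mulr0 ?add0r.
(* The horizontal points of the second lattice are the integer multiples of [(c, 0)], and [(a, 0)]
   is among them. *)
have horiz (a b c d : R) : 0 < a -> 0 < c ->
    farey_lattice (a, b) = farey_lattice (c, d) -> c <= a.
  move=> a0 c0 Eab.
  have : farey_lattice (a, b) (vec2 a 0).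
    by apply/memP => //; exists 1, 0; rewrite !mul0r mul1r addr0.
  rewrite Eab => /memP-/(_ c0)[m [n e]].
  have /esym/eqP := congr1 (@ycoord R) e; rewrite !coordE mulf_eq0 invr_eq0.
  rewrite (gt_eqF c0) orbF => /eqP n0.
  have := congr1 (@xcoord R) e; rewrite !coordE n0 mul0r addr0 => aE.
  move: a0; rewrite aE pmulr_lgt0 // ltr0z gtz0_ge1 -(ler1z R) => m1.
  by rewrite ler_peMl // ltW.
have xx' : x' = x.
  by apply/eqP; rewrite eq_le (horiz _ _ _ _ x0 x'0 E) (horiz _ _ _ _ x'0 x0 (esym E)).
rewrite xx' in E xy' *.
have : farey_lattice (x, y) (vec2 y x^-1).
  by apply/memP => //; exists 0, 1; rewrite !mul1r mul0r add0r.
rewrite E => /memP-/(_ x0)[m [n e]].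
have := congr1 (@ycoord R) e; rewrite !coordE => /(congr1 ( *%R^~ x)).
rewrite mulVf ?divfK ?gt_eqF // => n1.
have := congr1 (@xcoord R) e; rewrite !coordE -n1 mul1r => yE.
(* [m x] is a difference of two numbers in []1 - x, 1]], so [-1 < m < 1]. *)
have m0 : m = 0.
  have m1 : m%:~R * x < 1 * x by lra.
  have m2 : (- 1) * x < m%:~R * x by lra.
  move: m1 m2; rewrite !ltr_pM2r // -[1]/(1%:~R) -rmorphN !ltr_int.
  by clear; lia.
by rewrite yE m0 mul0r add0r.
Qed.

End Plane.

(** * Horizontal vectors, renormalization and the BCZ map *)

Section Corollary.
Context {R : realType}.
Implicit Types (q a t : R) (L : set 'cV[R]_2).

(** [h_mx alpha] keeps abscissas and makes exactly the line of slope [alpha] horizontal. So a short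
    horizontal vector comes, up to sign, from a lattice point of the strip of slope [alpha];
    strictly between the two slopes its abscissa would be at least [q1 + q2 > t]. *)
Lemma horizontal_iff_slope L t q1 a1 q2 a2 (alpha : R) :
  unimodular_lattice L -> consecutive2 (farey_points L t) (vec2 q1 a1) (vec2 q2 a2) ->
  a1 / q1 <= alpha <= a2 / q2 ->
  (exists w, [/\ act (h_mx alpha) L w, w <> 0, horizontal w & length2 w <= t])
  <-> (alpha = a1 / q1 \/ alpha = a2 / q2).
Proof.
move=> Lu uv; have [Luv q12] := consecutive2_unit_basis Lu uv.
have [duv LE] := Luv; have [Lp1 Lp2] := unit_basis_mem Luv.
case: uv => -[_ /andP[]] + + [_ /andP[]] + + _ _; rewrite !coordE in q12 *.
move=> q1_gt0 q1t q2_gt0 q2t /andP[al1 al2]; split; last first.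
  have wit q a : L (vec2 q a) -> 0 < q -> q <= t -> alpha = a / q ->
      exists w, [/\ act (h_mx alpha) L w, w <> 0, horizontal w & length2 w <= t].
    move=> Lqa q0 qt ->.
    have hE : h_mx (a / q) *m vec2 q a = vec2 q 0.
      by apply: cV2P; rewrite /h_mx !coordE; field; rewrite ?gt_eqF.
    exists (vec2 q 0); split.
    - by rewrite -hE; exists (vec2 q a).
    - by apply/cV2_neq0P; left; rewrite !coordE; apply/eqP; rewrite gt_eqF.
    - by rewrite /horizontal !coordE.
    - by rewrite /length2 !coordE expr0n addr0 sqrtr_sqr gtr0_norm.
  by case; apply: wit.
move=> [_ [[v Lv <-]]]; rewrite /horizontal /length2 cV2_neq0P /h_mx !coordE.
rewrite mul1r mul0r addr0 mul1r => /[swap] vy; rewrite vy expr0n addr0 sqrtr_sqr.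
move=> [|//] /eqP v0 vt.
(* Choose between [v] and [- v] the one with positive abscissa. *)
have [w Lw [w0 wt wy]] : exists2 w, L w &
    [/\ 0 < xcoord w, xcoord w <= t & ycoord w = alpha * xcoord w].
  have [v0'|v0'|v0'] := ltrgtP 0 (xcoord v); last by rewrite -v0' eqxx in v0.
    by exists v => //; split=> //; [rewrite -[xcoord v]gtr0_norm | lra].
  exists (- v).
    have /LE[m [n ->]] := Lv; apply/LE; exists (- m), (- n).
    by apply: cV2P; rewrite !coordE; ring.
  by rewrite !coordE; split; [lra | rewrite -(ltr0_norm v0') | lra].
apply: contrapT => /not_orP[/eqP ne1 /eqP ne2].
have sw : slope w = alpha by rewrite /slope wy mulfK // gt_eqF.
have uw : slope (vec2 q1 a1) < slope w.
  by rewrite sw /slope !coordE lt_neqAle eq_sym ne1.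
have wv : slope w < slope (vec2 q2 a2) by rewrite sw /slope !coordE lt_neqAle ne2.
rewrite !ltr_slope ?coordE // in uw wv.
have := unit_basis_between Luv Lw; rewrite !coordE => /(_ q1_gt0 q2_gt0 uw wv).
lra.
Qed.

(** The two given vectors form a basis of [L], and the renormalization sends them to the columns of
    the triangular matrix. *)
Lemma consecutive2_renormalized L t q1 a1 q2 a2 :
  unimodular_lattice L -> 0 < t ->
  consecutive2 (farey_points L t) (vec2 q1 a1) (vec2 q2 a2) ->
  act (mx2 (q1 / t) (q2 / t) 0 (q1 / t)^-1) (@Z2 R) =
  act (s_mx t^-1) (act (h_mx (a1 / q1)) L).
Proof.
move=> Lu t0 uv; have [[duv LE] _] := consecutive2_unit_basis Lu uv.
case: uv => -[_ /andP[]] + _ _ _ _.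
rewrite !coordE /det2 !coordE in duv * => q0.
have AE v : s_mx t^-1 *m h_mx (a1 / q1) *m v =
    vec2 (xcoord v / t) (t * (ycoord v - a1 / q1 * xcoord v)).
  by rewrite -mulmxA; apply: cV2P; rewrite /s_mx /h_mx !coordE ?invrK; ring.
have e1 : s_mx t^-1 *m h_mx (a1 / q1) *m vec2 q1 a1 = vec2 (q1 / t) 0.
  by rewrite AE; apply: cV2P; rewrite !coordE //; field; rewrite gt_eqF.
have e2 : s_mx t^-1 *m h_mx (a1 / q1) *m vec2 q2 a2 = vec2 (q2 / t) (q1 / t)^-1.
  rewrite AE; apply: cV2P; rewrite !coordE //.
  (* The relation [q1 a2 - a1 q2 = 1] solved for [a2]; it turns the ordinate into [t / q1]. *)
  have -> : a2 = (1 + a1 * q2) / q1.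
    by rewrite -duv; field; rewrite gt_eqF.
  by field; rewrite !gt_eqF.
rewrite actM; apply/seteqP; split=> w.
  move=> /act_Z2P[m [n]]; rewrite col0_mx2 col1_mx2 => ->.
  exists (m%:~R *: vec2 q1 a1 + n%:~R *: vec2 q2 a2); first by apply/LE; exists m, n.
  by rewrite mulmxDr -!scalemxAr e1 e2.
move=> [v /LE[m [n ->]] <-]; apply/act_Z2P; exists m, n.
by rewrite col0_mx2 col1_mx2 mulmxDr -!scalemxAr e1 e2.
Qed.

(** Ordinates are integer multiples of [1 / x], so horizontal points are the multiples [m (x, 0)],
    and a positive abscissa means [m >= 1]. *)
Lemma the_shortest_horizontal (x y : R) : 0 < x ->
  the_shortest [set w | [/\ act (mx2 x y 0 x^-1) (@Z2 R) w, horizontal w & 0 < xcoord w]]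
    (vec2 x 0).
Proof.
move=> x0; split.
  split; rewrite /horizontal ?coordE //.
  by apply/act_Z2P; exists 1, 0; rewrite col0_mx2 scale1r scale0r addr0.
move=> _ [/act_Z2P[m [n ->]]]; rewrite col0_mx2 col1_mx2 /horizontal /length2 !coordE.
rewrite mulr0 add0r => /eqP; rewrite mulf_eq0 invr_eq0 (gt_eqF x0) orbF => /eqP ->.
rewrite !mul0r !addr0 scale0r addr0 expr0n !addr0 !sqrtr_sqr => mx0 wne.
rewrite !gtr0_norm // ltr_pMl // ltr1z.
move: mx0; rewrite pmulr_lgt0 // ltr0z => m0.
have : m <> 1 by move=> m1; apply: wne; rewrite m1 scale1r.
lia.
Qed.

Lemma consecutive3_bcz L t q1 a1 q2 a2 q3 a3 :
  unimodular_lattice L -> 0 < t ->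
  consecutive3 (farey_points L t) (vec2 q1 a1) (vec2 q2 a2) (vec2 q3 a3) ->
  bcz (q1 / t, q2 / t) = (q2 / t, q3 / t).
Proof.
move=> Lu t0 [uv vw].
have [[duv LE] _] := consecutive2_unit_basis Lu uv.
have [[dvw _] q23] := consecutive2_unit_basis Lu vw.
case: vw => -[_ /andP[+ _]] [[+ _ _] /andP[_ +]] _ _.
move=> + /LE[m [n e]]; rewrite !coordE in q23 * => q2_gt0 q3t.
(* With [v3 = m v1 + n v2], the determinants of [(v1, v2)] and [(v2, v3)] are both 1, while the
   second is [- m] times the first. *)
have m1 : m%:~R = - 1 :> R.
  have : det2 (vec2 q2 a2) (vec2 q3 a3) = - m%:~R * det2 (vec2 q1 a1) (vec2 q2 a2).
    by rewrite e /det2 !coordE; ring.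
  by rewrite dvw duv mulr1 => mE; rewrite -[m%:~R]opprK -mE.
have := congr1 (@xcoord R) e; rewrite !coordE m1 => q3E.
rewrite /bcz /= (_ : Num.floor _ = n); first by congr pair; rewrite q3E; ring.
have -> : (1 + q1 / t) / (q2 / t) = (t + q1) / q2 by field; rewrite !gt_eqF.
(* As [q3 = n q2 - q1], the bounds [n <= (t + q1) / q2 < n + 1] say [q3 <= t < q2 + q3]. *)
apply/floor_def; rewrite ler_pdivlMr // ltr_pdivrMr // rmorphD /=.
by apply/andP; split; lra.
Qed.

End Corollary.

Unset Implicit Arguments.
Set Strict Implicit.

Theorem corollary5 (R : realType) (L : set 'cV[R]_2) (tau : R)
    (q1 a1 q2 a2 : R) :
  unimodular_lattice L ->
  0 < tau ->
  farey_points L tau !=set0 ->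
  consecutive2 (farey_points L tau) (vec2 q1 a1) (vec2 q2 a2) ->
  let L' := act (s_mx tau^-1) (act (h_mx (a1 / q1)) L) in
  let M := mx2 (q1 / tau) (q2 / tau) 0 (q1 / tau)^-1 in
  [/\ (* (a) *)
      forall alpha : R, a1 / q1 <= alpha <= a2 / q2 ->
        (exists w, [/\ act (h_mx alpha) L w, w <> 0, horizontal w
                     & length2 w <= tau])
        <-> (alpha = a1 / q1 \/ alpha = a2 / q2),
      (* (b) *)
      [/\ L' = act (h_mx (a1 / q1 * tau ^+ 2)) (act (s_mx tau^-1) L),
          positively_oriented_basis M L',
          consecutive2 (farey_points L' 1) (col 0 M) (col 1 M)
        & the_shortest [set w | [/\ L' w, horizontal w & 0 < xcoord w]]
            (vec2 (q1 / tau) 0)],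
      (* (c) *)
      [/\ farey_triangle (q1 / tau, q2 / tau),
          farey_lattice (q1 / tau, q2 / tau) = L'
        & forall p : R * R, farey_triangle p -> farey_lattice p = L' ->
            p = (q1 / tau, q2 / tau)]
    & (* (d) *)
      forall q3 a3 : R,
        consecutive3 (farey_points L tau)
          (vec2 q1 a1) (vec2 q2 a2) (vec2 q3 a3) ->
        bcz (q1 / tau, q2 / tau) = (q2 / tau, q3 / tau)].
Proof.
move=> Lu t0 _ uv L' M.
have [[duv _]] := consecutive2_unit_basis Lu uv.
rewrite !coordE => q12.
have [[_ /andP[]] + + [_ /andP[]] + + _ _] := uv; rewrite !coordE.
move=> q1_gt0 q1t q2_gt0 q2t.
have L'E : act M (@Z2 R) = L' := consecutive2_renormalized Lu t0 uv.
have x0 : 0 < q1 / tau by rewrite divr_gt0.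
have y0 : 0 < q2 / tau by rewrite divr_gt0.
have x1 : q1 / tau <= 1 by rewrite ler_pdivrMr // mul1r.
have y1 : q2 / tau <= 1 by rewrite ler_pdivrMr // mul1r.
have xy1 : 1 < q1 / tau + q2 / tau by rewrite -mulrDl ltr_pdivlMr // mul1r.
have tri : farey_triangle (q1 / tau, q2 / tau) by split; rewrite //= ?x0 ?y0.
have detM : \det M = 1.
  by rewrite det2_col col0_mx2 col1_mx2 /det2 !coordE mul0r subr0 mulfV ?gt_eqF.
split.
- by move=> alpha; apply: horizontal_iff_slope Lu uv.
- split.
  + rewrite /L' !actM; congr act.
    rewrite /s_mx /h_mx !mulmx2; congr mx2; rewrite ?invrK; field;
      by rewrite ?gt_eqF.
  + split; last by rewrite detM ltr01.
    by split; [rewrite unitmxE detM unitr1 | rewrite L'E].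
  (* The conditions of the Farey triangle are those of the converse criterion with [t = 1]. *)
  + by rewrite -L'E; apply: (unit_basis_consecutive2 (unit_basis_act detM));
      rewrite /M ?col0_mx2 ?col1_mx2 !coordE ?x0 ?y0.
  + by rewrite -L'E; apply: the_shortest_horizontal.
- split=> // p pT pE; apply: farey_lattice_inj => //.
  by rewrite pE -L'E.
- by move=> q3 a3; apply: consecutive3_bcz.
Qed.
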